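(* Let $n\ge 1$, let $a>0$, $b>0$ be constants, and let $f:\mathbb{R}^n\times[0,\infty)\to\mathbb{R}$ be a positive solution of $$f_t=\Delta f+af-bf^3$$ which is a standing solution, i.e. $f_t=0$ identically. Then $f$ is constant.
   Context: The equation $f_t=\Delta f+af-bf^3$ is the Newell-Whitehead equation; $\Delta$ is the Laplacian in the space variable $x\in\mathbb{R}^n$. ''Solution'' means a classical solution. *)

(* Defs.v *)
From HB Require Import structures.
From mathcomp Require Import all_boot all_order all_algebra.
From mathcomp Require Import all_classical all_reals all_analysis.

Set Implicit Arguments.
Unset Strict Implicit.
Unset Printing Implicit Defensive.
Import Order.TTheory GRing.Theory Num.Theory.
Import numFieldNormedType.Exports.

Local Open Scope classical_set_scope.
Local Open Scope ring_scope.

(* A function f on R^n x [0, oo) is represented by a total function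
   f : 'rV[R]_n -> R -> R; no definition below depends on the values f x t
   with t < 0. *)

Definition basis_vec (R : realType) (n : nat) (i : 'I_n) : 'rV[R]_n :=
  delta_mx 0 i.

Definition dx (R : realType) (n : nat) (i : 'I_n) (f : 'rV[R]_n -> R -> R) :
    'rV[R]_n -> R -> R :=
  fun x t => 'D_(basis_vec R i) (fun y => f y t) x.

Definition dt (R : realType) (n : nat) (f : 'rV[R]_n -> R -> R) :
    'rV[R]_n -> R -> R :=
  fun x t => derive1 (f x) t.

Definition laplacian (R : realType) (n : nat) (f : 'rV[R]_n -> R -> R) :
    'rV[R]_n -> R -> R :=
  fun x t => \sum_(i < n) dx i (dx i f) x t.

(* 'D and derive1 are total operators, so existence of the derivatives has to be
   required separately from their continuity. *)
Definition has_dx (R : realType) (n : nat) (i : 'I_n)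
    (f : 'rV[R]_n -> R -> R) : Prop :=
  forall x t, 0 < t -> derivable (fun y => f y t) x (basis_vec R i).

Definition has_dt (R : realType) (n : nat) (f : 'rV[R]_n -> R -> R) : Prop :=
  forall x t, 0 < t -> derivable (f x) t 1.

Definition continuous_pos_time (R : realType) (n : nat)
    (f : 'rV[R]_n -> R -> R) : Prop :=
  forall x t, 0 < t ->
    {for (x, t), continuous (fun p : 'rV[R]_n * R => f p.1 p.2)}.

(* C^{2,1}(R^n x (0, oo)): f, f_t, f_{x_i} and f_{x_i x_j} exist and are jointly
   continuous. *)
Definition C21 (R : realType) (n : nat) (f : 'rV[R]_n -> R -> R) : Prop :=
  [/\ continuous_pos_time f,
      has_dt f /\ continuous_pos_time (dt f),
      forall i, has_dx i f /\ continuous_pos_time (dx i f) &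
      forall i j, has_dx j (dx i f) /\ continuous_pos_time (dx j (dx i f))].

(* Classical solution on R^n x [0, oo): continuous up to t = 0, C^{2,1} and
   satisfying the equation for t > 0. *)
Definition newell_whitehead_solution (R : realType) (n : nat) (a b : R)
    (f : 'rV[R]_n -> R -> R) : Prop :=
  [/\ {within [set p : 'rV[R]_n * R | 0 <= p.2],
        continuous (fun p => f p.1 p.2)},
      C21 f &
      forall x t, 0 < t ->
        dt f x t = laplacian f x t + a * f x t - b * f x t ^+ 3].

Definition positive_solution (R : realType) (n : nat) (a b : R)
    (f : 'rV[R]_n -> R -> R) : Prop :=
  newell_whitehead_solution a b f /\ forall x t, 0 <= t -> 0 < f x t.

Definition standing (R : realType) (n : nat) (f : 'rV[R]_n -> R -> R) : Prop :=
  forall x t, 0 < t -> dt f x t = 0.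

(* Main.v *)
Require Import Defs.
From HB Require Import structures.
From mathcomp Require Import all_boot all_order all_algebra.
From mathcomp Require Import all_classical all_reals all_analysis.
From mathcomp Require Import ring lra.
Import Order.TTheory GRing.Theory Num.Theory.
Import numFieldNormedType.Exports.
Local Open Scope classical_set_scope.
Local Open Scope ring_scope.

(** A standing solution is, at each positive time, a positive function [u] on
R^n with [Delta u = b u^3 - a u]. Such a [u] satisfies [b u^2 = a] everywhere,
by comparison on a ball of radius [r] centred at an arbitrary point [y] with
functions of [rho x = r^2 - |x - y|^2].

From above, [u] is touched by a multiple of [1 / rho], which blows up on the
sphere so that no bound on [u] is needed beforehand. From below, it is touched
by a multiple of [rho^2], which vanishes on the sphere so that positivity of [u]
suffices. At the touching point the second derivatives of [u] along the
coordinate axes compare with those of the touching function; summing them and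
inserting the equation bounds [b (u y)^2 - a] by [C / r^2] from both sides
([interior_upper_bound], [interior_lower_bound]) with [C] depending only on [n].
Letting [r] tend to infinity gives [b (u y)^2 = a]
([solution_eq_equilibrium]), so that [f] is the constant [sqrt (a / b)] at
positive times, and at time 0 by continuity ([closed_time_cst]). *)

Set Implicit Arguments.
Unset Strict Implicit.
Unset Printing Implicit Defensive.

(** * Second derivatives at touching points *)

(** A negative second derivative at [c], together with a vanishing first one,
makes [g'] negative just to the right of [c], so that [g] drops below [g c].
Since [g''] is only required to exist at [c] itself, the last step is the mean
value theorem for [g] rather than a Taylor formula. *)
Lemma second_derivative_min_ge0 (R : realType) (g dg : R -> R) (c l : R) :
  (\forall h \near c, is_derive h (1 : R) g (dg h)) ->
  is_derive c (1 : R) dg l ->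
  (\forall h \near c, g c <= g h) -> 0 <= l.
Proof.
move=> gdg [dgc dgl] gmin; rewrite leNgt; apply/negP => l0.
have [e /= e0 He] : exists2 e : R, 0 < e & forall h, `|c - h| < e ->
    is_derive h (1 : R) g (dg h) /\ g c <= g h.
  have [e /= e0 He] := (nbhs_ballP _ _).1 (filterI gdg gmin).
  by exists e => // h ch; have /= := He h; apply.
have in_ball h : h \in `]c - e, c + e[%R -> `|c - h| < e.
  by rewrite in_itv/= ltr_norml => /andP[? ?]; apply/andP; split; lra.
have dgc0 : dg c = 0.
  have cc : c \in `]c - e, c + e[%R by rewrite in_itv/=; apply/andP; split; lra.
  rewrite -(@derive_val _ _ _ _ _ _ _ (He c (in_ball _ cc)).1).
  have dg0 : is_derive c (1 : R) g 0.
    apply: (@derive1_at_min R g (c - e) (c + e)) => //; first by lra.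
      by move=> t /in_ball/He[[]].
    by move=> t /in_ball/He[].
  by rewrite (@derive_val _ _ _ _ _ _ _ dg0).
have /(_ [set z | z < 0]) :
    (fun h => h^-1 *: ((dg \o shift c) (h *: (1 : R)) - dg c)) @ 0^' --> l.
  by rewrite -dgl; exact: dgc.
case=> [|d /= d0 Hd]; first exact: lt_nbhsl.
(* A step at which both the sign of the difference quotient of [dg] and the
   minimality of [g c] are available. *)
pose h := Num.min d e / 2.
have mde : 0 < Num.min d e by rewrite lt_min d0.
have h0 : 0 < h by rewrite /h divr_gt0.
have hd : h < d.
  have : Num.min d e <= d by rewrite ge_min lexx.
  by rewrite /h; lra.
have he : h < e.
  have : Num.min d e <= e by rewrite ge_min lexx orbT.
  by rewrite /h; lra.
have cch : c < c + h by lra.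
have near_c x : c <= x <= c + h -> `|c - x| < e.
  by case/andP => ? ?; rewrite ltr_norml; apply/andP; split; lra.
have [||x xI gE] := @MVT R g dg c (c + h) cch.
- move=> x; rewrite in_itv/= => /andP[/ltW cx /ltW xh].
  by apply: (He x (near_c x _)).1; rewrite cx.
- apply: derivable_within_continuous => x; rewrite in_itv/= => xI.
  by have [[]] := He x (near_c x xI).
move: xI; rewrite in_itv/= => /andP[cx xh].
have dgx : dg x < 0.
  have /= := Hd (x - c); rewrite /ball_/= sub0r normrN.
  have xc0 : 0 < x - c by lra.
  rewrite gtr0_norm// => /(_ _ (lt0r_neq0 xc0)).
  rewrite [_ *: 1]mulr1 subrK dgc0 subr0 [_ *: _]/(_ * _) pmulr_rlt0.
    by apply; lra.
  by rewrite invr_gt0.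
have := (He (c + h) (near_c _ _)).2.
rewrite lexx (ltW cch) => /(_ isT).
rewrite -subr_ge0 gE leNgt => /negP; apply.
by rewrite nmulr_rlt0// addrAC subrr add0r.
Qed.

Lemma is_derive_line (R : realType) (V W : normedModType R) (u : V -> W)
  (x v : V) (s : R) :
  derivable u (s *: v + x) v ->
  is_derive s (1 : R) (fun h => u (h *: v + x)) ('D_v u (s *: v + x)).
Proof.
have E : (fun h : R => h^-1 *: (((fun h => u (h *: v + x)) \o shift s)
      (h *: (1 : R)) - u (s *: v + x))) =
    (fun h : R => h^-1 *: ((u \o shift (s *: v + x)) (h *: v)
      - u (s *: v + x))).
  apply/funext => h /=; congr (_ *: (u _ - _)).
  by rewrite [h *: 1]mulr1 scalerDl addrA.
by move=> du; split; rewrite /derivable /derive E.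
Qed.

(** This is the second derivative test on the line through [x] directed by [v],
applied to [u - phi]. Comparing with a function of one variable keeps the
derivatives of the comparison functions explicit and one-dimensional, and asks
of [u] nothing but its iterated derivatives along [v]. *)
Lemma derive2_ge_touching_below (R : realType) (V : normedModType R)
    (u : V -> R) (x v : V) (phi dphi : R -> R) (l : R) :
  (forall z, derivable u z v) -> (forall z, derivable ('D_v u) z v) ->
  phi 0 = u x -> (\forall h \near (0 : R), phi h <= u (h *: v + x)) ->
  (\forall h \near (0 : R), is_derive h (1 : R) phi (dphi h)) ->
  is_derive (0 : R) (1 : R) dphi l ->
  l <= 'D_v ('D_v u) x.
Proof.
move=> du ddu e0 le dp ddp; rewrite -subr_ge0.
apply: (@second_derivative_min_ge0 R
  ((fun h => u (h *: v + x)) - phi) ((fun h => 'D_v u (h *: v + x)) - dphi) 0).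
- near=> h; apply: is_deriveB; last by near: h.
  exact: is_derive_line.
- apply: is_deriveB.
  by have := @is_derive_line R V R _ x v 0 (ddu (0 *: v + x));
    rewrite scale0r add0r.
- near=> h; rewrite !fctE scale0r add0r e0 subrr subr_ge0; near: h; exact: le.
Unshelve. all: by end_near. Qed.

Lemma derive2_le_touching_above (R : realType) (V : normedModType R)
    (u : V -> R) (x v : V) (phi dphi : R -> R) (l : R) :
  (forall z, derivable u z v) -> (forall z, derivable ('D_v u) z v) ->
  phi 0 = u x -> (\forall h \near (0 : R), u (h *: v + x) <= phi h) ->
  (\forall h \near (0 : R), is_derive h (1 : R) phi (dphi h)) ->
  is_derive (0 : R) (1 : R) dphi l ->
  'D_v ('D_v u) x <= l.
Proof.
move=> du ddu e0 le dp ddp; rewrite -subr_ge0.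
apply: (@second_derivative_min_ge0 R
  (phi - (fun h => u (h *: v + x))) (dphi - (fun h => 'D_v u (h *: v + x))) 0).
- near=> h; apply: is_deriveB; first by near: h.
  exact: is_derive_line.
- apply: is_deriveB.
  by have := @is_derive_line R V R _ x v 0 (ddu (0 *: v + x));
    rewrite scale0r add0r.
- near=> h; rewrite !fctE scale0r add0r e0 subrr subr_ge0; near: h; exact: le.
Unshelve. all: by end_near. Qed.

(** * Derivatives of the comparison functions along a line *)

(** The restriction of [ball_gap] to a coordinate line, see [ball_gap_line]. *)
Definition chord_gap (R : realType) (p d h : R) : R := p - 2 * d * h - h ^+ 2.

Section ChordGap.
Variables (R : realType) (p d : R).
Local Notation q := (chord_gap p d).

Lemma is_derive_chord_gap (h : R) : is_derive h (1 : R) q (- (2 * d) - 2 * h).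
Proof.
have -> : chord_gap p d =
    cst p - (2 * d) \*: (id : R -> R) - (id : R -> R) ^+ 2.
  by apply/funext => z; rewrite /chord_gap !fctE /=.
apply: is_derive_eq.
by rewrite /= expr1 /GRing.scale/= !mulr1 sub0r.
Qed.

Lemma chord_gap0 : q 0 = p.
Proof. by rewrite /chord_gap mulr0 expr0n /= !subr0. Qed.

Lemma near_chord_gap_gt0 : 0 < p -> \forall h \near (0 : R), 0 < q h.
Proof.
move=> p0.
have q0 : q @ (0 : R) --> q 0.
  apply/differentiable_continuous/derivable1_diffP.
  by have [] := is_derive_chord_gap 0.
apply: (q0 [set z | 0 < z]); apply: lt_nbhsr.
by rewrite chord_gap0.
Qed.

Lemma is_derive_sqr_chord_gap (k h : R) :
  is_derive h (1 : R) (fun z => k * q z ^+ 2)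
    (k * (2 * q h * (- (2 * d) - 2 * h))).
Proof.
have dq := is_derive_chord_gap h.
have -> : (fun z => k * q z ^+ 2) = k \*: (q ^+ 2) by [].
by apply: is_derive_eq; rewrite /= expr1 /GRing.scale/=.
Qed.

Lemma is_derive2_sqr_chord_gap (k : R) :
  is_derive (0 : R) (1 : R) (fun h => k * (2 * q h * (- (2 * d) - 2 * h)))
    (k * (8 * d ^+ 2 - 4 * p)).
Proof.
have dq := is_derive_chord_gap 0.
have -> : (fun h => k * (2 * q h * (- (2 * d) - 2 * h))) =
  k \*: ((2 \*: q) * (- (cst (2 * d)) - 2 \*: id)) by [].
apply: is_derive_eq; rewrite !fctE /GRing.scale/= /GRing.scale/=.
rewrite /chord_gap /cst; ring.
Qed.

Lemma is_derive_inv_chord_gap (k h : R) : q h != 0 ->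
  is_derive h (1 : R) (fun z => k * (q z)^-1)
    (k * ((2 * d + 2 * h) * (q h)^-1 ^+ 2)).
Proof.
move=> qn0; have dq := is_derive_chord_gap h.
have diq := is_deriveV qn0 dq.
have -> : (fun z => k * (q z)^-1) = k \*: (fun y => (q y)^-1) by [].
apply: is_derive_eq; rewrite /GRing.scale/= exprVn; ring.
Qed.

Lemma is_derive2_inv_chord_gap (k : R) : 0 < p ->
  is_derive (0 : R) (1 : R) (fun h => k * ((2 * d + 2 * h) * (q h)^-1 ^+ 2))
    (k * (2 * p^-1 ^+ 2 + 8 * d ^+ 2 * p^-1 ^+ 3)).
Proof.
move=> p0; have dq := is_derive_chord_gap 0.
have q0 : q 0 = p := chord_gap0.
have qn0 : q 0 != 0 by rewrite q0 gt_eqF.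
have diq := is_deriveV qn0 dq.
have -> : (fun h => k * ((2 * d + 2 * h) * (q h)^-1 ^+ 2)) =
  k \*: ((cst (2 * d) + 2 \*: id) * ((fun y => (q y)^-1) ^+ 2)) by [].
apply: is_derive_eq; rewrite !fctE /GRing.scale/= /GRing.scale/= q0 /cst -exprVn.
ring.
Qed.
End ChordGap.

(** * The power of a point with respect to a ball *)

(** The quadratic polynomial that is positive exactly in the open Euclidean ball
of centre [y] and radius [r]. *)
Definition ball_gap (R : realType) (n : nat) (r : R) (y x : 'rV[R]_n) : R :=
  r ^+ 2 - \sum_(i < n) (x 0 i - y 0 i) ^+ 2.

Section Gap.
Variables (R : realType) (n : nat) (r : R) (y : 'rV[R]_n).
Local Notation rho := (@ball_gap R n r y).

Lemma ball_gap_line (x : 'rV[R]_n) (i : 'I_n) (h : R) :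
  rho (h *: basis_vec R i + x) =
  chord_gap (rho x) (x 0 i - y 0 i) h.
Proof.
rewrite /chord_gap /ball_gap (bigD1 i)//= [in RHS](bigD1 i)//= !mxE !eqxx /=.
under eq_bigr => j ji do rewrite !mxE eqxx (negPf ji) /= mulr0 add0r.
ring.
Qed.

Lemma ball_gap_center : rho y = r ^+ 2.
Proof. by rewrite /ball_gap big1 ?subr0// => i _; rewrite subrr expr0n. Qed.

Lemma ball_gap_le x : rho x <= r ^+ 2.
Proof. by rewrite gerBl sumr_ge0// => i _; exact: sqr_ge0. Qed.

Lemma continuous_ball_gap : continuous rho.
Proof.
move=> x.
have ci i : {for x, continuous (fun z : 'rV[R]_n => (z 0 i - y 0 i) ^+ 2)}.
  have c : {for x, continuous ((fun z : 'rV[R]_n => z 0 i) - cst (y 0 i))}.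
    by apply: continuousB; [exact: coord_continuous|exact: cst_continuous].
  exact: (cvg_comp _ _ c (@exprn_continuous R 2 _)).
have cs : {for x, continuous (fun z : 'rV[R]_n =>
    \sum_(i < n) (z 0 i - y 0 i) ^+ 2)}.
  by apply: cvg_big => [||i _];
    [exact: add_continuous|exact: (nbhs_filter x)|exact: ci].
suff : {for x, continuous (cst (r ^+ 2) - (fun z : 'rV[R]_n =>
    \sum_(i < n) (z 0 i - y 0 i) ^+ 2))} by [].
by apply: continuousB => //; exact: cst_continuous.
Qed.

Lemma compact_ball_gap_ge0 : compact [set x | 0 <= rho x].
Proof.
apply: bounded_closed_compact.
  exists (`|y| + `|r|); split; first exact: num_real.
  move=> M ltM x /= rx.
  suff : `|x - y| <= `|r|.
    move=> xy; rewrite -(subrK y x); apply: (le_trans (ler_normD _ _)).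
    by apply: ltW; apply: le_lt_trans ltM; rewrite addrC lerD2l.
  rewrite [leLHS]/Num.norm/= mx_normrE.
  apply: bigmax_le => // -[i j] _ /=; rewrite !mxE ord1.
  rewrite -ler_sqr ?nnegrE// !real_normK ?num_real//.
  move: rx; rewrite /ball_gap subr_ge0; apply: le_trans.
  by rewrite (bigD1 j)//= lerDl sumr_ge0// => k _; exact: sqr_ge0.
have -> : [set x | 0 <= rho x] = rho @^-1` [set z | 0 <= z] by [].
apply: closed_comp; last exact: closed_ge.
by move=> x _; exact: continuous_ball_gap.
Qed.

(** Vanishing on the sphere and positivity at the centre force the maximum point
into the open ball, where second derivative tests apply. *)
Lemma exists_max_on_ball (w : 'rV[R]_n -> R) :
  (forall x, {for x, continuous w}) ->
  (forall x, rho x = 0 -> w x = 0) -> 0 < w y ->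
  exists2 x, 0 < rho x & forall z, 0 <= rho z -> w z <= w x.
Proof.
move=> cw wrho wy.
have [||x] := @compact_EVT_max _ R w _ _ compact_ball_gap_ge0.
- by exists y => /=; rewrite ball_gap_center sqr_ge0.
- by apply: continuous_subspaceT => x; exact: cw.
rewrite inE /= => rx0 xmax; exists x; last first.
  by move=> z rz; apply: xmax; rewrite inE.
rewrite lt_def rx0 andbT; apply/eqP => /wrho wx0.
have := xmax y; rewrite wx0 leNgt wy inE /= ball_gap_center sqr_ge0.
by move=> /(_ isT).
Qed.
End Gap.

(** * Two-sided interior estimates *)

Section Estimates.
Variables (R : realType) (n : nat) (a b : R) (u : 'rV[R]_n -> R).
Hypotheses (a0 : 0 < a) (b0 : 0 < b).
Hypothesis cu : forall x, {for x, continuous u}.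
Hypothesis du : forall i x, derivable u x (basis_vec R i).
Hypothesis ddu : forall i x, derivable ('D_(basis_vec R i) u) x (basis_vec R i).
Hypothesis u0 : forall x, 0 < u x.
Hypothesis eqn : forall x,
  \sum_(i < n) 'D_(basis_vec R i) ('D_(basis_vec R i) u) x =
  b * u x ^+ 3 - a * u x.

(** At a maximum point of [u * rho] over the ball, with maximum [M], the
function [M / rho] touches [u] from above. Since [M / rho] has Laplacian
[M (2 n / rho^2 + 8 |x - y|^2 / rho^3)], the equation multiplied by [rho^2 / u]
bounds [b M^2] by [a r^4] up to an error [O(r^2)], and [u y * r^2 <= M]. The
cubic term is strong enough because it scales like the Laplacian of the
blow-up rate [1 / rho]. *)
Lemma interior_upper_bound (r : R) (y : 'rV[R]_n) : 0 < r ->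
  b * u y ^+ 2 * r ^+ 2 <= a * r ^+ 2 + (2 * n%:R + 8).
Proof.
move=> r0; set rho := ball_gap r y.
have r20 : 0 < r ^+ 2 by rewrite exprn_gt0.
have [||| x p0 xmax] := @exists_max_on_ball R n r y (u \* rho).
- by move=> x; apply: continuousM; [exact: cu|exact: continuous_ball_gap].
- by move=> x rx; rewrite /rho /= rx mulr0.
- by rewrite /= /rho ball_gap_center mulr_gt0.
rewrite -/rho in p0 xmax; set p := rho x in p0 xmax.
have pn0 : p != 0 by rewrite gt_eqF.
pose M := u x * p.
have D2 i : 'D_(basis_vec R i) ('D_(basis_vec R i) u) x <=
    M * (2 * p^-1 ^+ 2 + 8 * (x 0 i - y 0 i) ^+ 2 * p^-1 ^+ 3).
  pose d := x 0 i - y 0 i.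
  apply: (@derive2_le_touching_above _ _ u x _
    (fun h => M * (chord_gap p d h)^-1) _ _ (@du i) (@ddu i)).
  - by rewrite chord_gap0 /M mulfK.
  - near=> h.
    have q0 : 0 < chord_gap p d h by near: h; exact: near_chord_gap_gt0.
    rewrite ler_pdivlMr//; have := xmax (h *: basis_vec R i + x).
    by rewrite /= /rho ball_gap_line; apply; exact: ltW.
  - near=> h; apply: is_derive_inv_chord_gap; rewrite gt_eqF//.
    by near: h; exact: near_chord_gap_gt0.
  - exact: is_derive2_inv_chord_gap.
have := ler_sum (index_enum 'I_n) (fun i (_ : xpredT i) => D2 i).
rewrite eqn -mulr_sumr big_split /= sumr_const card_ord -mulr_suml -mulr_sumr.
have -> : \sum_(i < n) (x 0 i - y 0 i) ^+ 2 = r ^+ 2 - p.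
  by rewrite /p /rho /ball_gap opprB addrC subrK.
move=> H.
have pr : p <= r ^+ 2 := ball_gap_le _ _ _.
have bM : b * M ^+ 2 <= (a * r ^+ 2 + (2 * n%:R + 8)) * r ^+ 2.
  (* The factor [p ^+ 2 / u x] clears the denominators on both sides. *)
  have {}H : (b * u x ^+ 3 - a * u x) * (p ^+ 2 / u x) <=
     M * (2 * p^-1 ^+ 2 *+ n + 8 * (r ^+ 2 - p) * p^-1 ^+ 3) * (p ^+ 2 / u x).
    by rewrite ler_wpM2r// divr_ge0 ?sqr_ge0 ?ltW.
  have ux0 : u x != 0 by rewrite gt_eqF.
  have E1 : (b * u x ^+ 3 - a * u x) * (p ^+ 2 / u x) = b * M ^+ 2 - a * p ^+ 2.
    by rewrite /M; field.
  have E2 : M * (2 * p^-1 ^+ 2 *+ n + 8 * (r ^+ 2 - p) * p^-1 ^+ 3) *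
      (p ^+ 2 / u x) = 2 * n%:R * p + 8 * (r ^+ 2 - p).
    by rewrite /M -mulr_natr; field; rewrite ux0 pn0.
  rewrite {}E1 {}E2 in H.
  have : a * p ^+ 2 <= a * (r ^+ 2 * r ^+ 2).
    by rewrite ler_pM2l// expr2 ler_pM// ltW.
  have : n%:R * p <= n%:R * r ^+ 2 by rewrite ler_wpM2l.
  by lra.
have uM : u y * r ^+ 2 <= M.
  have := xmax y; rewrite /= /rho ball_gap_center; apply; exact: sqr_ge0.
rewrite -(ler_pM2r r20); apply: le_trans bM.
have -> : b * u y ^+ 2 * r ^+ 2 * r ^+ 2 = b * (u y * r ^+ 2) ^+ 2 by ring.
rewrite ler_pM2l// ler_sqr ?nnegrE//.
  by rewrite mulr_ge0 ?sqr_ge0// ltW.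
by rewrite mulr_ge0// ltW.
Unshelve. all: by end_near. Qed.

(** At a maximum point of [rho^2 / u], a multiple [k rho^2] touches [u] from
below. The square matters: the Laplacian [8 |x - y|^2 - 4 n rho] of [rho^2] is
positive near the sphere, so a touching point at which [b u^2 < a] has [rho]
comparable to [r^2]; there the Laplacian costs only [O(r^-2)] relative to [u].
As [rho^2] is largest at the centre, [u y] is at least [u] at the touching
point. *)
Lemma interior_lower_bound (r : R) (y : 'rV[R]_n) : 0 < r ->
  a * r ^+ 2 <= b * u y ^+ 2 * r ^+ 2 + (4 * n%:R + 8) ^+ 2.
Proof.
move=> r0; set rho := ball_gap r y.
have r20 : 0 < r ^+ 2 by rewrite exprn_gt0.
have [||| x p0 xmax] := @exists_max_on_ball R n r y
    ((rho \* rho) \* (fun z => (u z)^-1)).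
- move=> x; apply: continuousM; last first.
    by apply: continuousV; [rewrite gt_eqF|exact: cu].
  by apply: continuousM; exact: continuous_ball_gap.
- by move=> x rx; rewrite /rho /= rx !mul0r.
- by rewrite /= /rho ball_gap_center divr_gt0// mulr_gt0.
rewrite -/rho in p0 xmax; set p := rho x in p0 xmax.
have pn0 : p != 0 by rewrite gt_eqF.
have ux0 : u x != 0 by rewrite gt_eqF.
pose k := u x / p ^+ 2.
have k0 : 0 < k by rewrite divr_gt0// exprn_gt0.
have below z : 0 <= rho z -> k * rho z ^+ 2 <= u z.
  move=> /xmax /=; rewrite -/p ler_pdivrMr// => /(ler_wpM2l (ltW k0)).
  rewrite -!expr2 => /le_trans; apply.
  by rewrite /k le_eqVlt; apply/orP; left; apply/eqP; field; rewrite ux0 pn0.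
have D2 i : k * (8 * (x 0 i - y 0 i) ^+ 2 - 4 * p) <=
    'D_(basis_vec R i) ('D_(basis_vec R i) u) x.
  pose d := x 0 i - y 0 i.
  apply: (@derive2_ge_touching_below _ _ u x _
    (fun h => k * (chord_gap p d h) ^+ 2) _ _ (@du i) (@ddu i)).
  - by rewrite chord_gap0 /k divfK// expf_neq0.
  - near=> h.
    have q0 : 0 < chord_gap p d h by near: h; exact: near_chord_gap_gt0.
    have := below (h *: basis_vec R i + x).
    by rewrite /rho ball_gap_line; apply; exact: ltW.
  - by near=> h; exact: is_derive_sqr_chord_gap.
  - exact: is_derive2_sqr_chord_gap.
have := ler_sum (index_enum 'I_n) (fun i (_ : xpredT i) => D2 i).
rewrite eqn -mulr_sumr big_split /= sumr_const card_ord -mulr_sumr.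
have -> : \sum_(i < n) (x 0 i - y 0 i) ^+ 2 = r ^+ 2 - p.
  by rewrite /p /rho /ball_gap opprB addrC subrK.
move=> H.
have pr : p <= r ^+ 2 := ball_gap_le _ _ _.
have uxy : u x <= u y.
  apply: le_trans (below y _); rewrite /rho ball_gap_center ?sqr_ge0//.
  have {1}-> : u x = k * p ^+ 2 by rewrite /k divfK// expf_neq0.
  by rewrite ler_pM2l// ler_sqr ?nnegrE ?(ltW p0) ?(ltW r20).
have N0 : 0 <= n%:R :> R by [].
have {}H : (a - b * u x ^+ 2) * p ^+ 2 + 8 * r ^+ 2 <= (4 * n%:R + 8) * p.
  have : k * (8 * (r ^+ 2 - p) + - (4 * p) *+ n) * (p ^+ 2 / u x) <=
      (b * u x ^+ 3 - a * u x) * (p ^+ 2 / u x).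
    by rewrite ler_wpM2r// divr_ge0 ?sqr_ge0 ?ltW.
  have -> : (b * u x ^+ 3 - a * u x) * (p ^+ 2 / u x) =
      (b * u x ^+ 2 - a) * p ^+ 2 by field.
  have -> : k * (8 * (r ^+ 2 - p) + - (4 * p) *+ n) * (p ^+ 2 / u x) =
      8 * (r ^+ 2 - p) - 4 * p * n%:R.
    by rewrite /k -mulr_natr; field; rewrite ux0 pn0.
  by lra.
apply: (@le_trans _ _ (b * u x ^+ 2 * r ^+ 2 + (4 * n%:R + 8) ^+ 2)); last first.
  rewrite lerD2r ler_wpM2r ?sqr_ge0// ler_pM2l//.
  by rewrite ler_sqr ?nnegrE ?(ltW (u0 _)).
set w := a - b * u x ^+ 2 in H.
suff : w * r ^+ 2 <= (4 * n%:R + 8) ^+ 2 by rewrite /w; lra.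
have [w0|w0] := leP w 0.
  by apply: le_trans (sqr_ge0 _); rewrite mulr_le0_ge0// ltW.
set C := 4 * n%:R + 8 in H *.
have C8 : 8 <= C by rewrite /C; lra.
(* [H] bounds [p] both from above in terms of [w] and from below in terms of
   [r]; the product of the two bounds gives the claim. *)
have wp : w * p <= C.
  have : 0 <= 8 * r ^+ 2 by lra.
  move=> ?; rewrite -(ler_pM2r p0); apply: le_trans H.
  by rewrite -mulrA -expr2 lerDl.
have rp : r ^+ 2 <= C * p.
  apply: le_trans H; apply: ler_wpDl; last lra.
  by rewrite mulr_ge0 ?sqr_ge0// ltW.
apply: (@le_trans _ _ (w * (C * p))); first by rewrite ler_pM2l.
by rewrite mulrCA expr2 ler_pM2l//; lra.
Unshelve. all: by end_near. Qed.

(** The errors in both estimates are independent of [r], hence negligible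
against [r^2] as the ball exhausts the space. *)
Lemma solution_eq_equilibrium y : b * u y ^+ 2 = a.
Proof.
have squeeze (A B C : R) : (forall r, 0 < r -> A * r ^+ 2 <= B * r ^+ 2 + C) ->
    A <= B.
  move=> H; rewrite leNgt; apply/negP => AB.
  (* A radius at least 1 such that [(A - B) * r] exceeds [C]. *)
  pose r := 1 + `|C| / (A - B).
  have AB0 : 0 < A - B by rewrite subr_gt0.
  have t0 : 0 <= `|C| / (A - B) by rewrite divr_ge0 // ltW.
  have := H r; have -> : 0 < r by rewrite /r; lra.
  move=> /(_ isT); apply/negP; rewrite -ltNge.
  have rr : r <= r ^+ 2 by rewrite expr2 ler_peMr /r; lra.
  have : C < (A - B) * r.
    rewrite /r mulrDr mulr1 [(A - B) * (_ / _)]mulrC divfK ?gt_eqF//.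
    by have := ler_norm C; lra.
  have : (A - B) * r <= (A - B) * r ^+ 2 by rewrite ler_pM2l.
  by lra.
apply/eqP; rewrite eq_le; apply/andP; split.
  by apply: squeeze => r r0; exact: interior_upper_bound.
by apply: squeeze => r r0; exact: interior_lower_bound.
Qed.
End Estimates.

(** * Standing solutions *)

Lemma closed_time_cst (R : realType) (n : nat) (f : 'rV[R]_n -> R -> R)
    (c : R) :
  {within [set p : 'rV[R]_n * R | 0 <= p.2], continuous (fun p => f p.1 p.2)} ->
  (forall x t, 0 < t -> f x t = c) -> forall x t, 0 <= t -> f x t = c.
Proof.
move=> /subspace_continuousP cf fc x t; rewrite le_eqVlt.
move=> /orP[/eqP <-|]; last exact: fc.
apply/eqP; apply: contraT => fx0.
have e0 : 0 < `|f x 0 - c| by rewrite normr_gt0 subr_eq0.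
have /= := cf (x, 0) (lexx _) _ (nbhsx_ballx (f x 0) _ e0).
case=> -[A B] /= [nA [d /= d0 dB]] AB.
have d20 : 0 < d / 2 by rewrite divr_gt0.
have xd : (A `*` B) (x, d / 2).
  split => /=; first exact: nbhs_singleton.
  by apply: dB; rewrite /= sub0r normrN gtr0_norm//; lra.
have : ball (f x 0) `|f x 0 - c| (f x (d / 2)) := AB _ xd (ltW d20).
by rewrite -ball_normE /= (fc x (d / 2))// ltxx.
Qed.

Unset Implicit Arguments.
Set Strict Implicit.

Theorem corollary4p4 (R : realType) (n : nat) (a b : R)
    (f : 'rV[R]_n -> R -> R) (hn : (1 <= n)%N) (ha : 0 < a) (hb : 0 < b)
    (hf : positive_solution a b f) (hst : standing f) :
  exists c : R, forall (x : 'rV[R]_n) (t : R), 0 <= t -> f x t = c.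
Proof.
have [[cf [cpos _ dxf ddxf] eqn] fpos] := hf.
exists (Num.sqrt (a / b)); apply: closed_time_cst cf _ => x t t0.
have fx0 y : 0 < f y t by apply: fpos; exact: ltW.
suff <- : b * f x t ^+ 2 = a.
  by rewrite mulrC mulKf ?gt_eqF// sqrtr_sqr gtr0_norm.
apply: (@solution_eq_equilibrium R n a b (fun y => f y t)) => //.
- move=> y; have cyt := cpos y t t0.
  have cpair : (fun z : 'rV[R]_n => (z, t)) @ y --> (y, t).
    by apply: (@cvg_pair _ _ _ (nbhs y) (nbhs y) (nbhs t));
      [exact: cvg_id|exact: cvg_cst].
  exact: (cvg_comp _ _ cpair cyt).
- by move=> i y; have [H _] := dxf i; exact: H.
- by move=> i y; have [H _] := ddxf i i; exact: H.
- move=> y; have := eqn y t t0; rewrite hst// /laplacian /dx => E.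
  by apply/eqP; rewrite -subr_eq0; apply/eqP; rewrite [RHS]E; ring.
Qed.
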